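(* Let $G$ be a graph of order $n\ge 3$. Then $C_t^{oi}(G)\le \alpha(G)+2$.
   Context: All graphs are finite, simple and undirected, with vertex set $V(G)$; the order is $|V(G)|$, and $\alpha(G)$ is the independence number (maximum size of an independent set). A set $D\subseteq V(G)$ is a total outer-independent dominating set (TOIDS) of $G$ if every vertex of $G$ is adjacent to at least one vertex of $D$ and $V(G)\setminus D$ is an independent set of $G$. Two nonempty disjoint sets $X,Y\subseteq V(G)$ form a TOI-coalition (are TOI-coalition partners) if neither $X$ nor $Y$ is a TOIDS of $G$ but $X\cup Y$ is a TOIDS of $G$. A TOI-coalition partition of $G$ is a partition $\Psi=\{V_1,\dots,V_k\}$ of $V(G)$ into nonempty sets such that for every $V_i\in\Psi$ there exists $V_j\in\Psi$, $j\ne i$, such that $V_i$ and $V_j$ form a TOI-coalition. The TOI-coalition number $C_t^{oi}(G)$ is the maximum cardinality of a TOI-coalition partition of $G$, with $C_t^{oi}(G)=0$ if $G$ has no TOI-coalition partition. *)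

(* Defs.v *)
From mathcomp Require Import all_boot.

Set Implicit Arguments.
Unset Strict Implicit.
Unset Printing Implicit Defensive.

(* A finite simple graph is a symmetric irreflexive relation
   e on a finType T; the definitions below make sense for any relation. *)
Section TOICoalition.

Variables (T : finType) (e : rel T).
Implicit Types (A D X Y : {set T}) (P : {set {set T}}).

Definition independent A : bool :=
  [forall x in A, forall y in A, ~~ e x y].

Definition alpha : nat := \max_(A : {set T} | independent A) #|A|.

(* Total domination: the vertices of D itself also need a neighbour in D. *)
Definition toids D : bool :=
  [forall x, exists y in D, e x y] && independent (~: D).

Definition toi_coalition X Y : bool :=
  [&& X != set0, Y != set0, [disjoint X & Y],
      ~~ toids X, ~~ toids Y & toids (X :|: Y)].

(* [partition] already requires the blocks to be nonempty. *)
Definition toi_coalition_partition P : bool :=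
  partition P [set: T] &&
  [forall X in P, exists Y in P, (Y != X) && toi_coalition X Y].

(* The maximum over an empty family is 0. *)
Definition toi_coalition_number : nat :=
  \max_(P : {set {set T}} | toi_coalition_partition P) #|P|.

End TOICoalition.

(* Main.v *)
Require Import Defs.
From mathcomp Require Import all_boot.

(** The bound already holds for every single coalition partition, because of
    one pair of partners: if [X] and [Y] form a coalition, then the complement
    of [X :|: Y] is independent, so it has at most [alpha e] vertices. The blocks
    other than [X] and [Y] are nonempty and pairwise disjoint and live in that
    complement, so there are at most [alpha e] of them. *)

Lemma card_independent_le_alpha (T : finType) (e : rel T) (A : {set T}) :
  independent e A -> #|A| <= alpha e.
Proof. by move=> indepA; rewrite /alpha (bigmax_sup A). Qed.

Lemma card_trivIset_le_cover (T : finType) (P : {set {set T}}) :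
  trivIset P -> set0 \notin P -> #|P| <= #|cover P|.
Proof.
move=> /eqP <- P0; rewrite -sum1_card; apply: leq_sum => A PA.
by rewrite card_gt0; apply: contraNneq P0 => <-.
Qed.

Lemma cover_other_blocks (T : finType) (P : {set {set T}}) (X Y : {set T}) :
  trivIset P -> X \in P -> Y \in P ->
  cover (P :\: [set X; Y]) \subset ~: (X :|: Y).
Proof.
move=> /trivIsetP tP PX PY; apply/bigcupsP => A.
rewrite !inE negb_or => /andP[/andP[AX AY] PA].
by rewrite setCU subsetI -!disjoints_subset !tP.
Qed.

Lemma card_coalition_partition (T : finType) (e : rel T) (P : {set {set T}}) :
  toi_coalition_partition e P -> #|P| <= alpha e + 2.
Proof.
case/andP=> /and3P[_ tP P0] /forall_inP partner.
have [->|[X PX]] := set_0Vmem P; first by rewrite cards0.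
have /exists_inP[Y PY /andP[_ /and5P[_ _ _ _ /andP[_ /andP[_ indep]]]]] :=
  partner X PX.
rewrite -(cardsID [set X; Y] P) addnC; apply: leq_add; last first.
  by rewrite (leq_trans (subset_leq_card (subsetIr _ _))) // cards2; case: eqP.
apply: leq_trans (card_independent_le_alpha _ _ _ indep).
apply: leq_trans (subset_leq_card (cover_other_blocks _ _ _ _ tP PX PY)).
apply: card_trivIset_le_cover; first exact: trivIsetS (subsetDl _ _) tP.
by rewrite inE (negPf P0) andbF.
Qed.

Theorem proposition3 (T : finType) (e : rel T)
    (e_sym : symmetric e) (e_irr : irreflexive e) (n_ge3 : 3 <= #|T|) :
  toi_coalition_number e <= alpha e + 2.
Proof. by apply/bigmax_leqP => P; apply: card_coalition_partition. Qed.
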